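(* The Laplace transform $\psi(s)=\mathbb{E}[e^{-sS^*}]$ of the stationary sojourn time $S^*$ is given, for $s\ge 0$, by $$ \psi(s)=\sum_{n=0}^{K-1}\psi(n+1,0,s)\,\pi_n+\phi(R,0,s)\,\pi_K . $$
   Context: Model (exponential inspection times). Let $\lambda,\gamma>0$, $0<\mu_0<\mu_1$, let $K\ge 1$ be an integer, and assume stability $\lambda<\mu_1$. Customers arrive to a single-server queue according to a Poisson process of rate $\lambda$, have i.i.d. exponential service requirements of mean $1$, and are served in order of arrival. The server works at rate $\mu_0$ or $\mu_1$. At the epochs of an independent Poisson process of rate $\gamma$ the system is inspected: if at an inspection the number of customers in the system is larger than $K$, the rate is immediately set to $\mu_1$; if it is at most $K$, the rate is set to $\mu_0$. Between inspections the rate is unchanged. Let $\pi_{in}$ ($i=0,1$, $n\ge 0$) be the stationary probability that the service rate is $\mu_i$ and there are $n$ customers in the system, and let $\pi_n=(\pi_{0n},\pi_{1n})^{\top}$ (column vector). Matrices: $I$ is the $2\times2$ identity, $M=\mathrm{diag}(\mu_0,\mu_1)$, $\Lambda=\lambda I$, $\Gamma_3=\begin{pmatrix}\gamma&0\\-\gamma&0\end{pmatrix}$, $H_3=M+\Lambda+\Gamma_3$. The matrix $R$ is the minimal non-negative solution of $\Lambda-H_3R+MR^2=0$; explicitly $$R=\begin{pmatrix}R_{00}&0\\ \frac{\gamma}{\mu_1}\frac{R_{00}}{1-R_{00}}&\frac{\lambda}{\mu_1}\end{pmatrix},\qquad R_{00}=\frac{\mu_0+\gamma+\lambda}{2\mu_0}-\sqrt{\left(\frac{\mu_0+\gamma+\lambda}{2\mu_0}\right)^2-\frac{\lambda}{\mu_0}},$$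 and the stationary distribution satisfies $\pi_{K+h}=R^h\pi_K$ for $h\ge 0$. For $i\in\{0,1\}$, $n,m\ge 0$, $S_i(n,m)$ denotes the remaining sojourn time of a tagged customer at position $n$ in the system (position $1$ is in service) with $m$ customers behind him, when the current service rate is $\mu_i$; $S_i(0,m)=0$. Equivalently, $S_i(n,m)$ is the time until the $n$-coordinate hits $0$ for the Markov chain on triples $(i,n,m)$ which, for $n\ge1$, jumps to $(i,n-1,m)$ at rate $\mu_i$, to $(i,n,m+1)$ at rate $\lambda$, and at rate $\gamma$ to $(j,n,m)$ with $j=1$ if $n+m>K$ and $j=0$ otherwise. Let $\psi_i(n,m,s)=\mathbb{E}[e^{-sS_i(n,m)}]$ and let $\psi(n,m,s)=(\psi_0(n,m,s),\psi_1(n,m,s))$ (row vector). For a $2\times 2$ matrix $Z$ with all eigenvalues in the open unit disk, the matrix generating function is $$\phi(Z,m,s)=\sum_{h=0}^\infty\psi(K+h+1,m,s)\,Z^h .$$ $S^*$ is the sojourn time of a customer arriving to the system in stationarity; by PASTA its law is the mixture of the laws of $S_i(n+1,0)$ with weights $\pi_{in}$, i.e. $\psi(s)=\mathbb{E}[e^{-sS^*}]=\sum_{n=0}^\infty\psi(n+1,0,s)\,\pi_n$. *)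

(* Defs.v *)
From HB Require Import structures.
From mathcomp Require Import all_boot all_order all_algebra.
From mathcomp Require Import all_classical all_reals all_analysis.

Set Implicit Arguments.
Unset Strict Implicit.
Unset Printing Implicit Defensive.

Import Order.TTheory GRing.Theory Num.Theory.
Import numFieldNormedType.Exports.
Local Open Scope classical_set_scope.
Local Open Scope ring_scope.

(* [mu i] is the service rate mu_i; for a boolean [c], [b *+ c] is [b] if [c]
   holds and [0] otherwise. *)

Definition inspected_mode (K n : nat) : 'I_2 := if (K < n)%N then 1 else 0.

Section StationaryQueue.
Context {R : realType}.

(* Flow into a state = flow out of it; a self-transition [q y y] contributes
   equally to both sides. *)
Record stationary (I : choiceType) (q : I -> I -> R) (p : I -> R) : Prop := {
  stationary_ge0 : forall x, 0 <= p x;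
  stationary_mass : (\esum_(x in [set: I]) (p x)%:E = 1)%E;
  stationary_balance : forall y,
    (\esum_(x in [set: I]) (p x * q x y)%:E
     = \esum_(z in [set: I]) (p y * q y z)%:E)%E }.

(* A state is (index of the service rate, number of customers). *)
Definition queue_rate (lambda gamma : R) (mu : 'I_2 -> R) (K : nat)
    (x y : 'I_2 * nat) : R :=
  let: (i, n) := x in
  lambda *+ (y == (i, n.+1))
  + mu i *+ ((0 < n)%N && (y == (i, n.-1)))
  + gamma *+ (y == (inspected_mode K n, n)).

Definition pi_col (pi : 'I_2 * nat -> R) (n : nat) : 'cV[R]_2 :=
  \col_i pi (i, n).

End StationaryQueue.

Section RateMatrix.
Context {R : realType}.
Variables (lambda gamma : R) (mu : 'I_2 -> R).

Definition mxM : 'M[R]_2 := diag_mx (\row_i mu i).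
Definition mxLambda : 'M[R]_2 := lambda%:M.
Definition mxGamma3 : 'M[R]_2 :=
  \matrix_(i, j) if j == 0 then (if i == 0 then gamma else - gamma) else 0.
Definition mxH3 : 'M[R]_2 := mxM + mxLambda + mxGamma3.

Definition nonneg_solution (X : 'M[R]_2) : Prop :=
  (forall i j, 0 <= X i j) /\ mxLambda - mxH3 *m X + mxM *m X ^+ 2 = 0.

Definition minimal_nonneg_solution (X : 'M[R]_2) : Prop :=
  nonneg_solution X /\
  forall X', nonneg_solution X' -> forall i j, X i j <= X' i j.

End RateMatrix.

(* (i, n, m): index of the service rate, position of the tagged customer,
   number of customers behind him. *)
Definition tagged_state := ('I_2 * nat * nat)%type.
Definition position (x : tagged_state) : nat := x.1.2.

Section TaggedCustomer.
Context {R : realType}.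
Variables (lambda gamma : R) (mu : 'I_2 -> R) (K : nat).

(* Only used at states of positive position. An inspection that leaves the
   service rate unchanged counts as a jump from the state to itself. *)
Definition tagged_rate (x y : tagged_state) : R :=
  let: (i, n, m) := x in
  mu i *+ (y == (i, n.-1, m))
  + lambda *+ (y == (i, n, m.+1))
  + gamma *+ (y == (inspected_mode K (n + m), n, m)).

Definition exit_rate (x : tagged_state) : R := mu x.1.1 + lambda + gamma.

Context {d : measure_display} {Omega : measurableType d}.

(* [Y k] is the state after [k] jumps and [T k] the holding time in that state;
   under [P x] the chain starts from [x].  The joint law of jump chain and
   holding times is prescribed up to the first visit to position 0 and is
   unconstrained afterwards. *)
Record tagged_chain (P : tagged_state -> probability Omega R)
    (Y : nat -> Omega -> tagged_state) (T : nat -> Omega -> R) : Prop := {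
  chain_measurable : forall k y, measurable (Y k @^-1` [set y]);
  holding_measurable : forall k, measurable_fun [set: Omega] (T k);
  holding_ge0 : forall k w, 0 <= T k w;
  chain_law : forall (x : tagged_state) (N : nat)
      (y : nat -> tagged_state) (t : nat -> R),
    (forall k, (k < N)%N -> (0 < position (y k))%N /\ 0 <= t k) ->
    P x [set w | (forall k, (k <= N)%N -> Y k w = y k) /\
                  (forall k, (k < N)%N -> t k < T k w)]
    = ((x == y 0%N)%:R *
        \prod_(k < N) (tagged_rate (y k) (y k.+1) / exit_rate (y k)
                       * expR (- (exit_rate (y k) * t k))))%:E }.

(* Time until the position hits 0: the sum of the holding times before that. *)
Definition hitting_time (Y : nat -> Omega -> tagged_state)
    (T : nat -> Omega -> R) (w : Omega) : \bar R :=
  (\sum_(0 <= k <oo | [forall j : 'I_k.+1, (0 < position (Y j w))%N])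
     (T k w)%:E)%E.

End TaggedCustomer.

Section Transforms.
Context {R : realType}.

Definition laplace d (Omega : measurableType d) (P : probability Omega R)
    (X : Omega -> \bar R) (s : R) : \bar R :=
  (\int[P]_w expeR (- (s%:E * X w)))%E.

Context {d : measure_display} {Omega : measurableType d}.
Variables (P : tagged_state -> probability Omega R) (S : Omega -> \bar R).

Definition psi (i : 'I_2) (n m : nat) (s : R) : R :=
  fine (laplace (P (i, n, m)) S s).

Definition psi_row (n m : nat) (s : R) : 'rV[R]_2 := \row_i psi i n m s.

Definition phi_series (K : nat) (Z : 'M[R]_2) (m : nat) (s : R)
    : nat -> 'rV[R]_2 :=
  series (fun h => psi_row (K + h + 1) m s *m Z ^+ h).

Definition phi (K : nat) (Z : 'M[R]_2) (m : nat) (s : R) : 'rV[R]_2 :=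
  limn (phi_series K Z m s).

End Transforms.

(* Main.v *)
Require Import Defs.
From HB Require Import structures.
From mathcomp Require Import all_boot all_order all_algebra.
From mathcomp Require Import all_classical all_reals all_analysis.
From mathcomp Require Import measurable_realfun.
From mathcomp Require Import ring lra.

Set Implicit Arguments.
Unset Strict Implicit.
Unset Printing Implicit Defensive.

Import Order.TTheory GRing.Theory Num.Theory.
Import numFieldNormedType.Exports.
Local Open Scope classical_set_scope.
Local Open Scope ring_scope.

(** By the law of [Sstar], its Laplace transform is the mixture
    [\sum_n psi_row (n + 1) *m pi_col n] of the transforms of the hitting times.
    Above level [K] the stationary vector is matrix-geometric,
    [pi_col (K + h) = Rmx ^+ h *m pi_col K], so the part of the sum over
    [n >= K] is the series [phi] applied to [pi_col K].  Three facts carry this.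

    - Matrix-geometric form ([pi_col_geometric]).  Above [K] every inspection
      selects the fast rate, so the balance equations form a linear recurrence
      of order two with constant matrix coefficients, whose characteristic
      equation is the one solved by [Rmx].  The defect
      [pi_col (K + h + 1) - Rmx *m pi_col (K + h)] is driven by the remaining
      characteristic roots, which are at least 1, so its
      coordinates, taken in turn, cannot decrease in modulus; but they tend to 0
      since [pi] is summable.  Hence they vanish.
      What is needed about [Rmx] is that it is lower triangular with diagonal
      below 1 ([minimal_rate_matrix]): one nonnegative solution has this shape,
      and minimality transfers it.

    - Convergence of [phi] ([cvg_phi_series]).  Since [Rmx] is triangular with
      diagonal below 1, some nonnegative row [v] satisfies
      [v - v *m Rmx = (1, 1)]; the column sums of the powers of [Rmx] then
      telescope and stay below [v].

    - Mixture formula ([ge0_integral_mixture_law]).  An equality of laws against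
      a countable mixture extends from sets to nonnegative functions, by
      transfer to the image measures and countable additivity of the integral
      in the measure. *)

(** * Sums over states *)

Lemma sum_ord2 (V : nmodType) (F : 'I_2 -> V) : \sum_i F i = F 0 + F 1.
Proof. by rewrite big_ord_recl big_ord1; congr (_ + F _); apply: val_inj. Qed.

Lemma ord2_cases (i : 'I_2) : i = 0 \/ i = 1.
Proof. by case: i => -[|[|//]] ?; [left|right]; exact: val_inj. Qed.

(** Lets a sum over all states of a transition rate be read off from a list of
    the finitely many possible jumps. *)
Lemma esum_finite_support (R : realType) (I : choiceType) (s : seq (R * I)) :
  (forall t, t \in s -> 0 <= t.1) ->
  (\esum_(x in [set: I]) (\sum_(t <- s) t.1 *+ (x == t.2))%:E
   = (\sum_(t <- s) t.1)%:E)%E.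
Proof.
elim: s => [|t s IH] s0.
  by rewrite big_nil esum1// => x _; rewrite big_nil.
have t0 : 0 <= t.1 by apply: s0; rewrite inE eqxx.
have s0' u : u \in s -> 0 <= u.1 by move=> us; apply: s0; rewrite inE us orbT.
under eq_esum do rewrite big_cons EFinD.
rewrite esumD => [||x _]; last 2 first.
- by move=> x _; rewrite lee_fin mulrn_wge0.
- by rewrite lee_fin big_seq sumr_ge0// => u us; rewrite mulrn_wge0// s0'.
rewrite IH// big_cons EFinD; congr (_ + _)%E.
rewrite -[RHS](@esum_set1 _ _ t.2 (fun=> t.1%:E)) ?lee_fin// [RHS]esum_mkcond.
apply: eq_esum => x _.
case: ifPn => [/set_mem ->|/negP xt]; first by rewrite eqxx.
by case: eqP => // xE; case: xt; rewrite xE inE.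
Qed.

Lemma esum_prod_nat (R : realType) (I : finType) (a : I * nat -> \bar R) :
  (forall x, 0 <= a x)%E ->
  (\esum_(x in [set: I * nat]) a x = \sum_(n <oo) \sum_i a (i, n))%E.
Proof.
move=> a0.
have -> : [set: I * nat] = \bigcup_n [set x | x.2 = n].
  by apply/seteqP; split=> // x _; exists x.2.
rewrite nneseries_sum_bigcup//; last first.
  by apply/trivIsetP => m n _ _ mn; apply/seteqP; split=> // x /= [xm xn];
    rewrite -xm xn eqxx in mn.
apply: eq_eseriesr => n _.
have -> : [set x | x.2 = n] = (fun i : I => (i, n)) @` setT.
  by apply/seteqP; split=> [[i m] /= <-|_ [i _ <-]]//; exists i.
rewrite esum_image; last by move=> i j _ _ [].
rewrite esum_fset//; last exact: finite_finset.
have -> : [set: I] = [set` index_enum I].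
  by apply/seteqP; split=> // i _ /=; exact: mem_index_enum.
by rewrite -fsbig_seq ?index_enum_uniq.
Qed.

Lemma stationary_cvg0 (R : realType) (I : choiceType) (q : I -> I -> R)
    (p : I -> R) (f : nat -> I) :
  stationary q p -> injective f -> p \o f @ \oo --> 0.
Proof.
move=> [p0 p1 _] f_inj.
apply: cvg_series_cvg_0; apply: nondecreasing_is_cvgn.
  by apply: nondecreasing_series => n _ _; exact: p0.
exists 1 => _ [N _ <-].
rewrite -lee_fin -p1 /series/= -sumEFin.
have p0E x : (0 <= (p x)%:E)%E by rewrite lee_fin.
apply: (@le_trans _ _ (\sum_(n <oo) (p (f n))%:E)%E).
  exact: nneseries_lim_ge.
rewrite nneseries_esumT// -(@esum_image _ _ _ setT f (fun x => (p x)%:E)).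
  rewrite esum_mkcond; apply: le_esum => x _.
  by case: ifP.
by move=> m n _ _; exact: f_inj.
Qed.

(** * Balance equations at positive levels *)

Section Balance.
Context {R : realType}.
Variables (lambda gamma : R) (mu : 'I_2 -> R) (K : nat) (pi : 'I_2 * nat -> R).
Hypotheses (lambda_gt0 : 0 < lambda) (gamma_gt0 : 0 < gamma).
Hypotheses (mu_gt0 : forall i, 0 < mu i).
Hypothesis pi_stationary : stationary (queue_rate lambda gamma mu K) pi.

(** The last term of the left-hand side is the flow of inspections: all those at
    level [n.+1] lead to the same rate, the one prescribed for that level.
    Inspections that keep the rate are counted on both sides. *)
Lemma balance (i : 'I_2) (n : nat) :
  pi (i, n) * lambda + pi (i, n.+2) * mu i
    + gamma * (pi (0, n.+1) + pi (1, n.+1)) *+ (i == inspected_mode K n.+1)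
  = pi (i, n.+1) * (lambda + mu i + gamma).
Proof.
have [p0 _ /(_ (i, n.+1)) B] := pi_stationary.
pose m := inspected_mode K n.+1.
pose inflow := [::
  (pi (i, n) * lambda, (i, n)); (pi (i, n.+2) * mu i, (i, n.+2));
  (pi (0, n.+1) * gamma *+ (i == m), (0 : 'I_2, n.+1));
  (pi (1, n.+1) * gamma *+ (i == m), (1 : 'I_2, n.+1))].
pose outflow := [:: (pi (i, n.+1) * lambda, (i, n.+2));
  (pi (i, n.+1) * mu i, (i, n)); (pi (i, n.+1) * gamma, (m, n.+1))].
have piM x c : 0 < c -> 0 <= pi x * c.
  by move=> c0; exact: mulr_ge0 (p0 x) (ltW c0).
have flow_in x : pi x * queue_rate lambda gamma mu K x (i, n.+1)
    = \sum_(t <- inflow) t.1 *+ (x == t.2).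
  case: x => j k; rewrite !big_cons big_nil /= !xpair_eqE eqSS.
  rewrite addr0 !mulrDr !mulrnAr -addrA; congr (_ + (_ + _)).
  - rewrite [j == i]eq_sym [k == n]eq_sym.
    by case: (eqVneq i j) => [<-|_]; case: (eqVneq n k) => [<-|_].
  - case: k => [|k]; first by rewrite /= andbF.
    rewrite /= eqSS [j == i]eq_sym [k == _]eq_sym.
    by case: (eqVneq i j) => [<-|_]; case: (eqVneq n.+1 k) => [<-|_].
  - rewrite [k == _]eq_sym; case: (eqVneq n.+1 k) => [<-|_].
      by rewrite !andbT -/m; case: (ord2_cases j) => ->; rewrite ?addr0 ?add0r.
    by rewrite !andbF addr0.
have flow_out z : pi (i, n.+1) * queue_rate lambda gamma mu K (i, n.+1) z
    = \sum_(t <- outflow) t.1 *+ (z == t.2).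
  by rewrite !big_cons big_nil /= addr0 !mulrDr !mulrnAr addrA.
move: B; rewrite (eq_esum (fun x _ => congr1 EFin (flow_in x))).
rewrite (eq_esum (fun x _ => congr1 EFin (flow_out x))).
rewrite !esum_finite_support.
- rewrite !big_cons !big_nil /= !addr0 -/m => -[] e.
  by rewrite -addrA [gamma * _]mulrC mulrDl mulrnDl e !mulrDr -addrA.
- by move=> t; rewrite !inE => /or3P[] /eqP ->; exact: piM.
- by move=> t; rewrite !inE => /or4P[] /eqP ->; rewrite /= ?mulrn_wge0// piM.
Qed.

End Balance.

(** * The rate matrix *)

Lemma matrix2P (R : Type) (A B : 'M[R]_2) :
  A 0 0 = B 0 0 -> A 0 1 = B 0 1 -> A 1 0 = B 1 0 -> A 1 1 = B 1 1 -> A = B.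
Proof.
move=> *; apply/matrixP => i j.
by case: (ord2_cases i) => ->; case: (ord2_cases j) => ->.
Qed.

Section RateMatrix.
Context {R : realType}.
Variables (lambda gamma : R) (mu : 'I_2 -> R).

Local Notation total := (mu 0 + gamma + lambda).

Definition quadratic_residual (X : 'M[R]_2) : 'M[R]_2 :=
  mxLambda lambda - mxH3 lambda gamma mu *m X + mxM mu *m X ^+ 2.

Lemma quadratic_residualE (X : 'M[R]_2) i j :
  quadratic_residual X i j
  = lambda *+ (i == j) - ((mu i + lambda) * X i j
       + (if i == 0 then gamma * X 0 j else - gamma * X 0 j))
    + mu i * (X i 0 * X 0 j + X i 1 * X 1 j).
Proof.
rewrite /quadratic_residual /mxH3 /mxM /mxLambda !mulmxDl !mul_diag_mx.
rewrite mul_scalar_mx expr2 -mulmxE !mxE !sum_ord2 !mxE /=.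
by rewrite mul0r addr0 -mulrDl; case: ifP.
Qed.

(** The quadratic is [lambda > 0] at 0 and [- gamma < 0] at 1; the witness is
    its smaller root, given by the quadratic formula. *)
Lemma exists_root (lambda_gt0 : 0 < lambda) (gamma_gt0 : 0 < gamma)
    (mu0_gt0 : 0 < mu 0) :
  exists2 r, 0 <= r < 1 & mu 0 * r ^+ 2 - total * r + lambda = 0.
Proof.
have total_gt0 : 0 < total by have := mu0_gt0; lra.
pose q := Num.sqrt (total ^+ 2 - 4 * mu 0 * lambda).
have q_ge0 : 0 <= q by exact: sqrtr_ge0.
have qE : q ^+ 2 = total ^+ 2 - 4 * mu 0 * lambda.
  rewrite sqr_sqrtr//.
  have := sqr_ge0 (mu 0 - lambda); have := mulr_gt0 gamma_gt0 lambda_gt0.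
  have := mulr_gt0 gamma_gt0 mu0_gt0; have := sqr_ge0 gamma; nra.
have q_le : q <= total.
  rewrite -ler_sqr ?nnegrE ?qE.
  - by have := mulr_gt0 mu0_gt0 lambda_gt0; lra.
  - by [].
  - exact: ltW.
have q_gt : total - 2 * mu 0 < q.
  rewrite ltNge; apply/negP => qle.
  have : q ^+ 2 <= (total - 2 * mu 0) ^+ 2 by rewrite ler_sqr ?nnegrE//; lra.
  by rewrite qE; have := mulr_gt0 gamma_gt0 mu0_gt0; lra.
exists ((total - q) / (2 * mu 0)).
  by rewrite divr_ge0 ?ltr_pdivrMr; lra.
have -> : mu 0 * ((total - q) / (2 * mu 0)) ^+ 2
    - total * ((total - q) / (2 * mu 0)) + lambda
  = (q ^+ 2 - (total ^+ 2 - 4 * mu 0 * lambda)) / (4 * mu 0).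
  by field; lra.
by rewrite qE subrr mul0r.
Qed.

(** The explicit matrix [Z] below is a nonnegative lower triangular solution
    with diagonal entries below 1, so the entries of the minimal solution, being
    smaller, obey the same bounds.  These bounds select the roots of the scalar
    equations contained in the matrix equation, so they determine [X]. *)
Lemma minimal_rate_matrix (lambda_gt0 : 0 < lambda) (gamma_gt0 : 0 < gamma)
    (mu0_gt0 : 0 < mu 0) (stable : lambda < mu 1) (X : 'M[R]_2) :
  minimal_nonneg_solution lambda gamma mu X ->
  [/\ 0 <= X 0 0 < 1, X 0 1 = 0, 0 <= X 1 0, 0 <= X 1 1 < 1
    & quadratic_residual X = 0].
Proof.
move=> [[X0 XE] Xmin].
have [r /andP[r0 r1] rE] := exists_root lambda_gt0 gamma_gt0 mu0_gt0.
have mu1_gt0 : 0 < mu 1 by exact: lt_trans stable.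
pose Z : 'M[R]_2 := \matrix_(i, j)
  if i == 0 then (if j == 0 then r else 0)
  else (if j == 0 then gamma * r / (mu 1 * (1 - r)) else lambda / mu 1).
have Z01 : Z 0 1 = 0 by rewrite mxE.
have Zmin : forall i j, X i j <= Z i j.
  apply: Xmin; split.
    move=> i j; rewrite mxE; do 2 case: ifP => // _;
      rewrite ?divr_ge0// ?mulr_ge0//; lra.
  rewrite -/(quadratic_residual Z).
  apply: matrix2P; rewrite quadratic_residualE !mxE /=.
  - by lra.
  - by lra.
  - by field; apply/andP; split; lra.
  - by field; lra.
split=> //.
- by rewrite X0/=; have := Zmin 0 0; rewrite mxE /=; lra.
- by apply/eqP; rewrite eq_le X0 -[X in _ <= X]Z01 Zmin.
- rewrite X0/=; have := Zmin 1 1; rewrite mxE /= => /le_lt_trans; apply.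
  by rewrite ltr_pdivrMr// mul1r.
Qed.

End RateMatrix.

(** * Matrix-geometric form of the stationary distribution *)

Lemma expanding_cvg0 (R : realType) (e : nat -> R) :
  (forall h, `|e h| <= `|e h.+1|) -> e @ \oo --> 0 -> forall h, e h = 0.
Proof.
move=> e_exp e0 h; apply/eqP; rewrite -normr_le0.
have n0 : `|e k| @[k --> \oo] --> (0 : R) by exact/norm_cvg0P.
rewrite -[leRHS](cvg_lim _ n0)//.
apply: (nondecreasing_cvgn_le (u_ := fun k => `|e k|)).
  exact/nondecreasing_seqP.
exact: cvgP n0.
Qed.

(** Since [X] is lower triangular, the two coordinates are treated in turn.  The
    defect of the slow coordinate is multiplied at each level by the larger root
    of the quadratic of [X 0 0], which exceeds 1.  Once that defect is known to
    vanish, the defect of the fast coordinate is constant: the other root of the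
    quadratic of [X 1 1] is 1. *)
Lemma pi_col_geometric (R : realType) (lambda gamma : R) (mu : 'I_2 -> R)
    (K : nat) (pi : 'I_2 * nat -> R) (X : 'M[R]_2)
    (lambda_gt0 : 0 < lambda) (gamma_gt0 : 0 < gamma)
    (mu0_gt0 : 0 < mu 0) (stable : lambda < mu 1) :
  stationary (queue_rate lambda gamma mu K) pi ->
  minimal_nonneg_solution lambda gamma mu X ->
  forall h, pi_col pi (K + h) = X ^+ h *m pi_col pi K.
Proof.
move=> pi_st Xmin.
have [/andP[a0 a1] X01 c0 /andP[d0 d1] XE] :=
  minimal_rate_matrix lambda_gt0 gamma_gt0 mu0_gt0 stable Xmin.
have mu1_gt0 : 0 < mu 1 by exact: lt_trans stable.
have mu_gt0 i : 0 < mu i by case: (ord2_cases i) => ->.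
have := congr1 (fun A : 'M[R]_2 => A 0 0) XE.
have := congr1 (fun A : 'M[R]_2 => A 1 0) XE.
have := congr1 (fun A : 'M[R]_2 => A 1 1) XE.
rewrite !quadratic_residualE !mxE X01 /= => E11 E10 E00.
move: a0 a1 E11 E10 E00; set a := X 0 0 => a0 a1 E11 E10 E00.
move: c0 E11 E10 E00; set c := X 1 0 => c0 E11 E10 E00.
move: d0 d1 E11 E10 E00; set d := X 1 1 => d0 d1 E11 E10 E00.
(* The quadratic of [d] has roots 1 and [lambda / mu 1], and [d < 1]. *)
have dE : mu 1 * d = lambda.
  have /eqP : (1 - d) * (lambda - mu 1 * d) = 0 by lra.
  by rewrite mulf_eq0 => /orP[] /eqP ?; lra.
have cE : mu 1 * c * (1 - a) = gamma * a.
  have : mu 1 * (d * c) = lambda * c by rewrite mulrA dE.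
  lra.
pose x i h := pi (i, (K + h)%N).
have x_cvg i : x i @ \oo --> 0.
  apply: (stationary_cvg0 (f := fun h => (i, (K + h)%N)) pi_st).
  by move=> m n [] /addnI.
have xS_cvg i : (fun h => x i h.+1) @ \oo --> 0.
  apply: (stationary_cvg0 (f := fun h => (i, (K + h.+1)%N)) pi_st).
  by move=> m n [] /addnI[].
have bal i h : x i h * lambda + x i h.+2 * mu i
    + gamma * (x 0 h.+1 + x 1 h.+1) *+ (i == 1)
    = x i h.+1 * (lambda + mu i + gamma).
  have := balance lambda_gt0 gamma_gt0 mu_gt0 pi_st i (K + h).
  by rewrite /x !addnS /inspected_mode ltnS leq_addr.
have step0 h : x 0 h.+1 = a * x 0 h.
  apply/eqP; rewrite -subr_eq0; apply/eqP; move: h.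
  apply: expanding_cvg0; last first.
    have <- : 0 - a * 0 = 0 by rewrite mulr0 subr0.
    by apply: cvgB => //; apply: cvgMl_tmp.
  move=> h.
  have eS : mu 0 * (x 0 h.+2 - a * x 0 h.+1)
          = (mu 0 + gamma + lambda - mu 0 * a) * (x 0 h.+1 - a * x 0 h).
    have := bal 0 h; rewrite /= mulr0n.
    have : a * (mu 0 + gamma + lambda - mu 0 * a) * x 0 h = lambda * x 0 h.
      by congr (_ * _); lra.
    lra.
  (* The factor in [eS] is [mu 0] times the other root of the quadratic. *)
  have growth : mu 0 < mu 0 + gamma + lambda - mu 0 * a.
    rewrite -subr_gt0 -(@pmulr_lgt0 _ (1 - a)) ?subr_gt0//.
    by rewrite [X in 0 < X](_ : _ = gamma)//; lra.
  rewrite -(ler_pM2l mu0_gt0) -{2}(gtr0_norm mu0_gt0) -normrM eS normrM.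
  by rewrite ler_wpM2r//; exact: le_trans (ltW growth) (ler_norm _).
have step1 h : x 1 h.+1 = c * x 0 h + d * x 1 h.
  apply/eqP; rewrite -subr_eq0; apply/eqP; move: h.
  apply: expanding_cvg0; last first.
    have <- : 0 - (c * 0 + d * 0) = 0 by rewrite !mulr0 addr0 subr0.
    by apply: cvgB => //; apply: cvgD; apply: cvgMl_tmp.
  move=> h; rewrite le_eqVlt; apply/orP; left; apply/eqP; congr `|_|.
  apply: (mulfI (lt0r_neq0 mu1_gt0)).
  have := bal 1 h; rewrite /= mulr1n step0.
  have := congr1 (fun z => z * x 0 h) cE.
  have := congr1 (fun z => z * x 1 h) dE.
  have := congr1 (fun z => z * x 1 h.+1) dE.
  lra.
elim=> [|h IH]; first by rewrite addn0 expr0 mul1mx.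
rewrite exprS -mulmxE -mulmxA -IH; apply/matrixP => i j.
rewrite !mxE sum_ord2 !mxE.
have [->|->] := ord2_cases i; last exact: step1.
by rewrite X01 mul0r addr0; exact: step0.
Qed.

(** * Convergence of the matrix generating function *)

Lemma cvg_row (R : realType) n (u : nat -> 'rV[R]_n.+1) :
  (forall j, cvgn (fun h => u h 0 j)) -> cvgn u.
Proof.
move=> u_cvg; apply/cvg_ex; pose l j := limn (fun h => u h 0 j).
exists (\sum_j l j *: delta_mx 0 j).
rewrite (_ : u = fun h => \sum_j u h 0 j *: delta_mx 0 j); last first.
  by apply/funext => h; rewrite -row_sum_delta.
apply: cvg_big => [|j _]; first exact: add_continuous.
by apply: cvgZl; exact: u_cvg.
Qed.

(** Writing the row of ones as [v - v *m Z], the partial sums of the column sums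
    of [Z ^+ h] telescope to [v - v *m Z ^+ N <= v].  They dominate the partial
    sums of the series, which increase. *)
Lemma cvg_power_series (R : realType) n (Z : 'M[R]_n.+1) (v : 'rV[R]_n.+1)
    (u : nat -> 'rV[R]_n.+1) :
  (forall i j, 0 <= Z i j) -> (forall j, 0 <= v 0 j) ->
  v - v *m Z = const_mx 1 ->
  (forall h j, 0 <= u h 0 j <= 1) ->
  cvgn (series (fun h => u h *m Z ^+ h)).
Proof.
move=> Z0 v0 vE u01.
have ZX0 h i j : 0 <= (Z ^+ h) i j.
  elim: h i j => [|h IH] i j; first by rewrite expr0 mxE mulrn_wge0.
  by rewrite exprS -mulmxE mxE sumr_ge0// => k _; rewrite mulr_ge0.
have uZ0 h j : 0 <= (u h *m Z ^+ h) 0 j.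
  by rewrite mxE sumr_ge0// => k _; rewrite mulr_ge0//; case/andP: (u01 h k).
apply: cvg_row => j.
rewrite (_ : (fun N => _) = series (fun h => (u h *m Z ^+ h) 0 j)); last first.
  by apply/funext => N; rewrite /series/= summxE.
apply: nondecreasing_is_cvgn; first by apply: nondecreasing_series => h _ _.
exists (v 0 j) => _ [N _ <-].
apply: (@le_trans _ _ ((v - v *m Z ^+ N) 0 j)); last first.
  by rewrite !mxE gerBl sumr_ge0// => k _; rewrite mulr_ge0.
have -> : v - v *m Z ^+ N = \sum_(0 <= h < N) const_mx 1 *m Z ^+ h.
  elim: N => [|N IH]; first by rewrite big_nil expr0 mulmx1 subrr.
  by rewrite big_nat_recr//= -IH -vE mulmxBl -mulmxA mulmxE -exprS addrA subrK.
rewrite summxE; apply: ler_sum => h _; rewrite !mxE; apply: ler_sum => k _.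
by rewrite mxE ler_wpM2r//; case/andP: (u01 h k).
Qed.

Lemma cvg_phi_series (R : realType) (lambda gamma : R) (mu : 'I_2 -> R)
    (X : 'M[R]_2) (u : nat -> 'rV[R]_2)
    (lambda_gt0 : 0 < lambda) (gamma_gt0 : 0 < gamma)
    (mu0_gt0 : 0 < mu 0) (stable : lambda < mu 1) :
  minimal_nonneg_solution lambda gamma mu X ->
  (forall h j, 0 <= u h 0 j <= 1) ->
  cvgn (series (fun h => u h *m X ^+ h)).
Proof.
move=> Xmin; have [X0 _] := Xmin.1.
have [/andP[_ a1] X01 c0 /andP[_ d1] _] :=
  minimal_rate_matrix lambda_gt0 gamma_gt0 mu0_gt0 stable Xmin.
have a1' : 1 - X 0 0 != 0 by lra.
have d1' : 1 - X 1 1 != 0 by lra.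
(* The solution of [v - v *m X = (1, 1)], by back substitution from column 1. *)
pose v : 'rV[R]_2 := \row_j if j == 0
  then (1 + X 1 0 / (1 - X 1 1)) / (1 - X 0 0) else (1 - X 1 1)^-1.
apply: (@cvg_power_series _ _ X v) => //.
  move=> j; rewrite mxE; case: ifP => _; last by rewrite invr_ge0; lra.
  by apply: divr_ge0; [apply: addr_ge0; [|apply: divr_ge0]|]; lra.
apply/matrixP => i j; rewrite ord1 !mxE sum_ord2 !mxE /=.
by have [->|->] := ord2_cases j; rewrite ?X01 /=; field; rewrite a1' d1'.
Qed.

Lemma continuous_affine_form (R : realType) n (b : 'rV[R]_1) (c : 'cV[R]_n) :
  continuous (fun A : 'rV[R]_n => (b + A *m c) 0 0).
Proof.
move=> A.
rewrite (_ : (fun _ => _) =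
    fun A : 'rV[R]_n => b 0 0 + \sum_j A 0 j * c j 0).
  apply: (@continuousD _ R^o _ (cst (b 0 0))
    (fun A : 'rV[R]_n => \sum_j A 0 j * c j 0)).
    exact: cst_continuous.
  apply: (cvg_big (@add_continuous R^o) (nbhs_filter A)) => j _.
  by apply: cvgMr_tmp; exact: coord_continuous.
by apply/funext => B; rewrite !mxE.
Qed.

(** * Laplace transforms of mixtures *)

(** Both sides are integrals of [f] on the common target [T]: the image measure
    of [P'] under [X'] is the sum of the series of the image measures of the
    [P i] under [X], scaled by the weights.  The enumeration [e] turns the sum
    over [I] into a series of measures. *)
Lemma ge0_integral_mixture_law (R : realType)
    (d d' dT : measure_display) (Omega : measurableType d)
    (Omega' : measurableType d') (T : measurableType dT) (I : choiceType)
    (e : nat -> I) (w : I -> R) (P : I -> {measure set Omega -> \bar R})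
    (P' : {measure set Omega' -> \bar R}) (X : Omega -> T) (X' : Omega' -> T)
    (f : T -> \bar R) :
  set_bij setT setT e -> (forall i, 0 <= w i) ->
  measurable_fun setT X -> measurable_fun setT X' -> measurable_fun setT f ->
  (forall x, 0 <= f x)%E ->
  (forall A, measurable A -> P' (X' @^-1` A)
     = \esum_(i in [set: I]) ((w i)%:E * P i (X @^-1` A)))%E ->
  (\int[P']_x f (X' x)
   = \esum_(i in [set: I]) ((w i)%:E * \int[P i]_x f (X x)))%E.
Proof.
move=> e_bij w0 mX mX' mf f0 law.
pose m_ n : {measure set T -> \bar R} :=
  mscale (NngNum (w0 (e n))) (pushforward (P (e n)) X).
(* The measure structure of an image needs a proof of measurability, which has
   become a parameter of [m_]. *)
pose m := m_ mX.
have mE A : measurable A -> pushforward P' X' A = mseries m 0 A.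
  move=> mA; rewrite /pushforward law// (reindex_esum _ _ _ _ e_bij).
  rewrite -nneseries_esumT//.
  by move=> n; rewrite mule_ge0// lee_fin.
rewrite -[LHS](@ge0_integral_pushforward _ _ _ _ _ _ mX' P' setT f)//.
rewrite (eq_measure_integral (mseries m 0)); last by move=> A mA _; exact: mE.
rewrite ge0_integral_measure_series//.
rewrite (reindex_esum _ _ _ _ e_bij) -nneseries_esumT; last first.
  by move=> n; rewrite mule_ge0 ?lee_fin// integral_ge0.
apply: eq_eseriesr => n _; rewrite ge0_integral_mscale//=.
by rewrite (ge0_integral_pushforward mX).
Qed.

Lemma bij_nat_prod (n : nat) :
  exists e : nat -> 'I_n.+1 * nat, set_bij setT setT e.
Proof.
exists (fun k => (inord (k %% n.+1), k %/ n.+1)%N); rewrite setTT_bijective.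
exists (fun x : 'I_n.+1 * nat => x.2 * n.+1 + x.1)%N => [k|[i m]] /=.
  by rewrite inordK ?ltn_pmod// -divn_eq.
by rewrite modnMDl modn_small// inord_val divnMDl// divn_small// addn0.
Qed.

Lemma measurable_expeR (R : realType) : measurable_fun [set: \bar R] (@expeR R).
Proof.
have mset (z : \bar R) : measurable_fun setT (fun x : \bar R => x == z).
  apply: (measurable_fun_bool true); rewrite setTI.
  rewrite (_ : _ @^-1` _ = [set z]); first exact: emeasurable_set1.
  by apply/seteqP; split=> x /= /eqP.
rewrite (_ : expeR = fun x => if x == +oo%E then +oo%E
    else if x == -oo%E then 0%E else (expR (fine x))%:E); last first.
  by apply/funext => -[x| |].
apply: measurable_fun_ifT; [exact: mset|exact: measurable_cst|].
apply: measurable_fun_ifT; [exact: mset|exact: measurable_cst|].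
apply/measurable_EFinP; apply: measurableT_comp; first exact: measurable_expR.
exact: fine_measurable.
Qed.

Lemma measurable_laplace_kernel (R : realType) (s : R) :
  measurable_fun [set: \bar R] (fun x => expeR (- (s%:E * x))%E).
Proof.
apply: measurableT_comp; first exact: measurable_expeR.
apply: measurableT_comp; first exact: oppe_measurable.
exact: measurable_funeM.
Qed.

Lemma measurable_hitting_time (R : realType) (d : measure_display)
    (Omega : measurableType d) (Y : nat -> Omega -> tagged_state)
    (T : nat -> Omega -> R) :
  (forall k y, measurable (Y k @^-1` [set y])) ->
  (forall k, measurable_fun setT (T k)) -> (forall k w, 0 <= T k w) ->
  measurable_fun setT (hitting_time Y T).
Proof.
move=> mY mT T0.
rewrite (_ : hitting_time Y T = fun w => (\sum_(k <oo | k \in xpredT)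
  if [forall j : 'I_k.+1, (0 < position (Y j w))%N] then (T k w)%:E else 0)%E);
  last by apply/funext => w; rewrite /hitting_time eseries_mkcond.
apply: ge0_emeasurable_sum => [k w _ _|k _]; first
  by case: ifP => // _; rewrite lee_fin.
apply: measurable_fun_ifT; last exact: measurable_cst;
  last exact/measurable_EFinP.
apply: (measurable_fun_bool true); rewrite setTI.
rewrite (_ : _ @^-1` _ = \bigcap_(j in [set: 'I_k.+1])
   \bigcup_(y in [set y | (0 < position y)%N]) Y j @^-1` [set y]); last first.
  apply/seteqP; split=> w /=.
    by move=> /forallP + j _ => /(_ j) ?; exists (Y j w).
  by move=> Yw; apply/forallP => j; have [y /= y0 ->] := Yw j I.
apply: fin_bigcap_measurable => [|j _]; first exact: finite_finset.
rewrite bigcup_mkcond.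
apply: countable_bigcupT_measurable => [|y]; first exact: countableP.
by case: ifP.
Qed.

Lemma laplace_bounds (R : realType) (d : measure_display)
    (Omega : measurableType d) (P : probability Omega R) (S : Omega -> \bar R) (s : R) :
  measurable_fun setT S -> (forall w, 0 <= S w)%E -> 0 <= s ->
  (0 <= laplace P S s <= 1)%E.
Proof.
move=> mS S0 s0; rewrite /laplace integral_ge0//=; last first.
  by move=> w _; exact: expeR_ge0.
rewrite -[leRHS](probability_setT P) -[leRHS]mul1e -integral_cst//.
apply: ge0_le_integral => //=.
- by move=> w _; exact: expeR_ge0.
- exact: measurableT_comp (measurable_laplace_kernel s) mS.
- by move=> w _; rewrite -expeR0 lee_expeR oppe_le0 mule_ge0.
Qed.

(** * The stationary sojourn time *)

Theorem proposition3p2 (R : realType) (lambda gamma : R) (mu : 'I_2 -> R)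
    (K : nat)
    (lambda_gt0 : 0 < lambda) (gamma_gt0 : 0 < gamma)
    (mu0_gt0 : 0 < mu 0) (mu0_lt_mu1 : mu 0 < mu 1) (K_ge1 : (1 <= K)%N)
    (stable : lambda < mu 1)
    (pi : 'I_2 * nat -> R)
    (pi_stationary : stationary (queue_rate lambda gamma mu K) pi)
    (Rmx : 'M[R]_2)
    (Rmx_minimal : minimal_nonneg_solution lambda gamma mu Rmx)
    (d : measure_display) (Omega : measurableType d)
    (P : tagged_state -> probability Omega R)
    (Y : nat -> Omega -> tagged_state) (T : nat -> Omega -> R)
    (chain : tagged_chain lambda gamma mu K P Y T)
    (d' : measure_display) (Omega' : measurableType d')
    (P' : probability Omega' R) (Sstar : Omega' -> \bar R)
    (Sstar_measurable : measurable_fun [set: _] Sstar)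
    (Sstar_law : forall A : set (\bar R), measurable A ->
      (P' (Sstar @^-1` A)
       = \esum_(x in [set: 'I_2 * nat])
           ((pi x)%:E * P (x.1, x.2.+1, 0%N) (hitting_time Y T @^-1` A)))%E)
    (s : R) (s_ge0 : 0 <= s) :
  let S := hitting_time Y T in
  cvgn (phi_series P S K Rmx 0 s) /\
  laplace P' Sstar s
  = ((\sum_(0 <= n < K) psi_row P S (n + 1) 0 s *m pi_col pi n
      + phi P S K Rmx 0 s *m pi_col pi K) 0 0)%:E.
Proof.
move=> S; have [mY mT T0 _] := chain.
have mS : measurable_fun setT S by exact: measurable_hitting_time.
have S0 w : (0 <= S w)%E.
  by apply: nneseries_ge0 => k _ _; rewrite lee_fin.
have psiE i n m : laplace (P (i, n, m)) S s = (psi P S i n m s)%:E.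
  have /andP[l0 l1] := laplace_bounds (P (i, n, m)) mS S0 s_ge0.
  by rewrite fineK// ge0_fin_numE// (le_lt_trans l1)// ltry.
have psi01 i n m : 0 <= psi P S i n m s <= 1.
  by rewrite -!lee_fin -psiE; exact: laplace_bounds.
have phi_cvg : cvgn (phi_series P S K Rmx 0 s).
  apply: (cvg_phi_series lambda_gt0 gamma_gt0 mu0_gt0 stable Rmx_minimal).
  by move=> h j; rewrite mxE.
split=> //.
pose a n := (psi_row P S (n + 1) 0 s *m pi_col pi n) 0 0.
have -> : laplace P' Sstar s = (\sum_(n <oo) (a n)%:E)%E.
  have [e e_bij] := bij_nat_prod 1.
  have pi0 := stationary_ge0 pi_stationary.
  rewrite /laplace (ge0_integral_mixture_law e_bij pi0 mS Sstar_measurable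
    (measurable_laplace_kernel s) (fun x => expeR_ge0 _) Sstar_law).
  rewrite esum_prod_nat; last first.
    move=> x; rewrite mule_ge0 ?lee_fin// integral_ge0// => w _.
    exact: expeR_ge0.
  apply: eq_eseriesr => n _; rewrite /a mxE -sumEFin; apply: eq_bigr => i _.
  by rewrite !mxE addn1 mulrC EFinM -psiE.
suff a_cvg : series a @ \oo -->
    (\sum_(0 <= n < K) psi_row P S (n + 1) 0 s *m pi_col pi n
    + phi P S K Rmx 0 s *m pi_col pi K) 0 0.
  apply: cvg_lim => //.
  rewrite (_ : (fun n => _) = EFin \o series a); last first.
    by apply/funext => n; rewrite /series/= sumEFin.
  exact: (cvg_comp _ _ a_cvg).
(* From index [K] on, the partial sums are those of [phi] applied to
   [pi_col pi K], plus a constant. *)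
rewrite -(cvg_shiftn K).
rewrite (_ : [sequence _]_n = fun n =>
    (\sum_(0 <= k < K) psi_row P S (k + 1) 0 s *m pi_col pi k
    + phi_series P S K Rmx 0 s n *m pi_col pi K) 0 0); last first.
  apply/funext => n; rewrite /series/= addnC (big_cat_nat _ (leq_addr n K))//=.
  rewrite mxE summxE; congr (_ + _).
  rewrite -{1}[K]add0n big_addn addKn /phi_series /series/= mulmx_suml summxE.
  apply: eq_bigr => h _; rewrite /a [(h + K)%N]addnC.
  by rewrite (pi_col_geometric lambda_gt0 gamma_gt0 mu0_gt0 stable pi_stationary
    Rmx_minimal) mulmxA.
apply: (@continuous_cvg _ _ _ _ _ _
  (fun A : 'rV[R]_2 => (_ + A *m pi_col pi K) 0 0)).
  exact: continuous_affine_form.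
exact: phi_cvg.
Qed.
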